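(* In virtual equipment type theory (VETT), let $\mathbb C$ be a small category. Then one can construct terms (natural elements) of the following types: 1. (Identity) $\forall\alpha{:}\mathbb C.\;\alpha\to_{\mathbb C}\alpha$. 2. (Composition) $\forall\alpha_1{:}\mathbb C.\;(\alpha_1\to_{\mathbb C}\alpha_2)\triangleright^{\forall\alpha_2:\mathbb C}\big((\alpha_2\to_{\mathbb C}\alpha_3)\triangleright^{\forall\alpha_3:\mathbb C}(\alpha_1\to_{\mathbb C}\alpha_3)\big)$. 3. (Functoriality) for any category $\mathbb D$ and any $F:\mathrm{Fun}\,\mathbb C\,\mathbb D$: $\forall\alpha_1{:}\mathbb C.\;(\alpha_1\to_{\mathbb C}\alpha_2)\triangleright^{\forall\alpha_2:\mathbb C}(F(\alpha_1)\to_{\mathbb D}F(\alpha_2))$. 4. (Profunctoriality) for any small category $\mathbb D$ and any $R:\mathrm{Prof}\,\mathbb C\,\mathbb D$: $\forall\alpha_1{:}\mathbb C.\;(\alpha_1\to_{\mathbb C}\alpha_2)\triangleright^{\forall\alpha_2:\mathbb C}\Big(R\,\alpha_2\,\beta_2\triangleright^{\forall\beta_2:\mathbb D}\big((\beta_2\to_{\mathbb D}\beta_1)\triangleright^{\forall\beta_1:\mathbb D}R\,\alpha_1\,\beta_1\big)\Big)$.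
   Context: **Judgments of VETT.** All judgments are relative to a context $\Gamma$ (suppressed below) of an extensional Martin-Löf dependent type theory. (i) Categories $\mathbb C$ Cat, some of which are small. (ii) Objects (functors) $\alpha:\mathbb C\vdash a:\mathbb D$, with exactly one free variable; variable rule $\alpha:\mathbb C\vdash\alpha:\mathbb C$. (iii) Sets (profunctors) $\Xi\vdash R$ Set, where a set context $\Xi$ is either $\alpha:\mathbb C$ or $\alpha:\mathbb C;\beta:\mathbb D$ (first variable contravariant, second covariant). In the first case $d^-\Xi=d^+\Xi=(\alpha:\mathbb C)$; in the second $d^-\Xi=(\alpha:\mathbb C)$, $d^+\Xi=(\beta:\mathbb D)$. (iv) Elements (natural transformations) $\Phi\vdash s:R$. A transformation context is $\Phi=\alpha_1:\mathbb C_1,x_1:R_1,\alpha_2:\mathbb C_2,\dots,x_n:R_n,\alpha_{n+1}:\mathbb C_{n+1}$ ($n\ge0$), each $R_i$ a set in context $\alpha_i:\mathbb C_i;\alpha_{i+1}:\mathbb C_{i+1}$. Put $d^-\Phi=\alpha_1:\mathbb C_1$, $d^+\Phi=\alpha_{n+1}:\mathbb C_{n+1}$, and $\underline\Phi=(\alpha_1:\mathbb C_1)$ if $n=0$, $\underline\Phi=d^-\Phi;d^+\Phi$ otherwise; $R$ must be a set in context $\underline\Phi$. Variable rule: $\alpha:\mathbb C,x:R,\beta:\mathbb D\vdash x:R$ (ordered, linear). If $d^+\Phi=d^-\Psi$, $\Phi\Join\Psi$ is concatenation sharing the common variable. **Substitution (admissible).** Objects substitute for object variables in objects; $R[a/\alpha;b/\beta]$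 is a set in $\Xi$ when $R$ is a set in $\alpha:\mathbb C;\beta:\mathbb D$, $d^-\Xi\vdash a:\mathbb C$, $d^+\Xi\vdash b:\mathbb D$. A transformation substitution $\Psi\vdash\phi::\Phi$ is $\phi=a_1/\alpha_1,s_1/x_1,a_2/\alpha_2,\dots,s_n/x_n,a_{n+1}/\alpha_{n+1}$ with $\Psi=\Psi_1\Join\dots\Join\Psi_n$, $d^-\Psi_i\vdash a_i:\mathbb C_i$, $d^+\Psi_i\vdash a_{i+1}:\mathbb C_{i+1}$, $\Psi_i\vdash s_i:R_i[a_i/\alpha_i;a_{i+1}/\alpha_{i+1}]$ (for $n=0$: $\Psi=\beta:\mathbb D$ and $\beta:\mathbb D\vdash a_1:\mathbb C_1$); it sends $\Phi\vdash s:R$ to $\Psi\vdash s[\phi]:R[a_1/\alpha_1;a_{n+1}/\alpha_{n+1}]$. Equality is the congruence generated by the $\beta\eta$ rules (extensional style). **Connectives used here** (VETT has further connectives not needed for this statement). - $\mathrm{Fun}\,\mathbb C\,\mathbb D$ is the meta-language type of functors: terms are $\lambda\alpha.a$ for objects $\alpha:\mathbb C\vdash a:\mathbb D$, with application $M\,a$ and $\beta\eta$. $\mathrm{Prof}\,\mathbb C\,\mathbb D$ is the type of profunctors: terms are $\lambda\alpha;\beta.R$ for sets $R$ in $\alpha:\mathbb C;\beta:\mathbb D$, with application $M\,a\,b$ (a set in $\Xi$ when $d^-\Xi\vdash a:\mathbb C$, $d^+\Xi\vdash b:\mathbb D$) and $\beta\eta$. For a set $P$ in context $\alpha:\mathbb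 C$, $\forall\alpha{:}\mathbb C.P$ is the type of natural elements: terms are $\lambda\alpha.t$ for elements $\alpha:\mathbb C\vdash t:P$, and $\beta:\mathbb D\vdash M^a:P[a/\alpha]$ for $M:\forall\alpha.P$, $\beta:\mathbb D\vdash a:\mathbb C$, with $\beta\eta$. - Unit (morphism set): for $d^-\Xi\vdash a:\mathbb C$, $d^+\Xi\vdash b:\mathbb C$, a set $a\to_{\mathbb C}b$ in $\Xi$. Introduction $\beta:\mathbb D\vdash\mathrm{id}_a:a\to_{\mathbb C}a$ for $\beta:\mathbb D\vdash a:\mathbb C$. Elimination: from a set $P$ in $\alpha:\mathbb C;\beta:\mathbb C$, $\alpha:\mathbb C\vdash t:P[\alpha/\alpha;\alpha/\beta]$ and $\Phi\vdash s:a\to_{\mathbb C}b$, infer $\Phi\vdash\mathrm{ind}_\to(\alpha.t,a,s,b):P[a/\alpha;b/\beta]$. $\beta$: $\mathrm{ind}_\to(\alpha.t,a,\mathrm{id}_a,a)=t[a/\alpha]$. $\eta$: for $\alpha_1:\mathbb C,z:\alpha_1\to_{\mathbb C}\alpha_2,\alpha_2:\mathbb C\vdash s:R$, $s=\mathrm{ind}_\to(\alpha.s[\alpha/\alpha_1,\mathrm{id}_\alpha/z,\alpha/\alpha_2],\alpha_1,z,\alpha_2)$. - Right hom: if the category of $d^+\Xi$ is small, $R$ a set in $d^+\Xi;\alpha:\mathbb C$, $P$ a set in $d^-\Xi;\alpha:\mathbb C$, a set $R\triangleright^{\forall\alpha:\mathbb C}P$ in $\Xi$. From $\Phi,x:R,\alpha:\mathbb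 C\vdash t:P$ infer $\Phi\vdash\lambda^\triangleright(x,\alpha).t:R\triangleright^{\forall\alpha}P$; from $\Phi_f\vdash s:R\triangleright^{\forall\alpha}P$, $d^+\Phi_a\vdash a:\mathbb C$, $\Phi_a\vdash t:R[a/\alpha]$ infer $\Phi_f\Join\Phi_a\vdash s\triangleright^at:P[a/\alpha]$; $\beta$: $(\lambda^\triangleright(x,\alpha).s)\triangleright^at=s[t/x,a/\alpha]$; $\eta$: $s=\lambda^\triangleright(x,\alpha).(s\triangleright^\alpha x)$. - Left hom: if the category of $d^-\Xi$ is small, $R$ a set in $\alpha:\mathbb C;d^-\Xi$, $P$ a set in $\alpha:\mathbb C;d^+\Xi$, a set $P\,{}^{\forall\alpha:\mathbb C}\!\triangleleft R$ in $\Xi$. From $\alpha:\mathbb C,x:R,\Phi\vdash t:P$ infer $\Phi\vdash\lambda^\triangleleft(\alpha,x).t:P\,{}^{\forall\alpha}\!\triangleleft R$; from $d^-\Phi_a\vdash a:\mathbb C$, $\Phi_a\vdash s:R[a/\alpha]$, $\Phi_f\vdash t:P\,{}^{\forall\alpha}\!\triangleleft R$ infer $\Phi_a\Join\Phi_f\vdash s\,{}^a\!\triangleleft t:P[a/\alpha]$; $\beta$: $s\,{}^a\!\triangleleft(\lambda^\triangleleft(\alpha,x).t)=t[a/\alpha,s/x]$; $\eta$: $t=\lambda^\triangleleft(\alpha,x).(x\,{}^\alpha\!\triangleleft t)$. *)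

(* Defs.v *)
From Stdlib Require Import List Arith.
Import ListNotations.

Set Implicit Arguments.
Unset Strict Implicit.
Unset Printing Implicit Defensive.

(** * Raw syntax

    There are two layers of variables.

    Variables of the outer context [Γ] (extensional Martin-Löf type theory) are
    de Bruijn indices [tvar n]; they may occur in every syntactic class.

    Object variables and element variables need no names.  An object has
    exactly one free object variable, written [ovar].  In a set over a set
    context Ξ, the variable meant by an occurrence of [ovar] is forced by its
    position: the source of a morphism set and the first argument of a
    profunctor are objects over d⁻Ξ, the target and the second argument are
    objects over d⁺Ξ.  Thus [hom C ovar ovar] is (α →_C β) in context α;β and
    (α →_C α) in context α.  In an element the variables x_1, ..., x_n of the
    transformation context are used exactly once and in order, so that each is
    written [evar]; [rlam] binds the last one and [llam] the first one.

    VETT, as far as it is used here, has no rule forming categories; they are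
    supplied by a signature of base symbols.  A symbol takes one parameter from
    a closed type of the outer theory, so families of categories depending on Γ
    are available. *)


Inductive tm (K : Type) : Type :=
  | tvar (n : nat)
  | tstar
  | tlam (M : tm K)                         (* binds one tvar *)
  | tapp (M N : tm K)
  | tpair (M N : tm K)
  | tfst (M : tm K)
  | tsnd (M : tm K)
  | trefl
  | mFun (a : obj K)                        (* λα. a *)
  | mProf (R : set K)                       (* λα;β. R *)
  | mAll (t : el K)                         (* λα. t, a natural element *)
with cat (K : Type) : Type :=
  | cbase (k : K) (M : tm K)
with obj (K : Type) : Type :=
  | ovar
  | oapp (M : tm K) (a : obj K)             (* M a, for M : Fun C D *)
with set (K : Type) : Type :=
  | hom (C : cat K) (a b : obj K)           (* a →_C b *)
  | papp (M : tm K) (a b : obj K)           (* M a b, for M : Prof C D *)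
  | rhom (C : cat K) (R P : set K)          (* R ▷^{∀α:C} P *)
  | lhom (C : cat K) (P R : set K)          (* P ^{∀α:C}◁ R *)
with el (K : Type) : Type :=
  | evar
  | eid (a : obj K)                         (* id_a *)
  | eind (t : el K) (a : obj K) (s : el K) (b : obj K) (* ind→(α.t, a, s, b) *)
  | rlam (t : el K)                         (* λ▷(x,α). t *)
  | rapp (s : el K) (a : obj K) (t : el K)  (* s ▷^a t *)
  | llam (t : el K)                         (* λ◁(α,x). t *)
  | lapp (s : el K) (a : obj K) (t : el K)  (* s ^a◁ t *)
  | eall (M : tm K) (a : obj K).            (* M^a, for M : ∀α:C. P *)


Inductive ty (K : Type) : Type :=
  | tUnit
  | tPi (A B : ty K)                        (* B binds one tvar *)
  | tSigma (A B : ty K)                     (* B binds one tvar *)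
  | tId (A : ty K) (M N : tm K)
  | tFun (C D : cat K)                      (* Fun C D *)
  | tProf (C D : cat K)                     (* Prof C D *)
  | tAll (C : cat K) (P : set K)            (* ∀α:C. P *).

Arguments tUnit {K}.
Arguments tvar {K} n.
Arguments tstar {K}.
Arguments trefl {K}.
Arguments ovar {K}.
Arguments evar {K}.

(** [cpar k] is the type of the parameter of the category symbol [k]. *)
Record signature : Type := Signature {
  csym : Type;
  cpar : csym -> ty csym;
  csmall : csym -> Prop }.

(** * Substitution for the variables of Γ

    [f k n] is the image of the variable [n] under [k] binders. *)

Fixpoint tm_map K (f : nat -> nat -> tm K) (k : nat) (M : tm K) : tm K :=
  match M with
  | tvar n => f k n
  | tstar => tstar
  | tlam M => tlam (tm_map f (S k) M)
  | tapp M N => tapp (tm_map f k M) (tm_map f k N)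
  | tpair M N => tpair (tm_map f k M) (tm_map f k N)
  | tfst M => tfst (tm_map f k M)
  | tsnd M => tsnd (tm_map f k M)
  | trefl => trefl
  | mFun a => mFun (obj_map f k a)
  | mProf R => mProf (set_map f k R)
  | mAll t => mAll (el_map f k t)
  end
with cat_map K (f : nat -> nat -> tm K) (k : nat) (C : cat K) : cat K :=
  match C with
  | cbase c M => cbase c (tm_map f k M)
  end
with obj_map K (f : nat -> nat -> tm K) (k : nat) (a : obj K) : obj K :=
  match a with
  | ovar => ovar
  | oapp M a => oapp (tm_map f k M) (obj_map f k a)
  end
with set_map K (f : nat -> nat -> tm K) (k : nat) (R : set K) : set K :=
  match R with
  | hom C a b => hom (cat_map f k C) (obj_map f k a) (obj_map f k b)
  | papp M a b => papp (tm_map f k M) (obj_map f k a) (obj_map f k b)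
  | rhom C R P => rhom (cat_map f k C) (set_map f k R) (set_map f k P)
  | lhom C P R => lhom (cat_map f k C) (set_map f k P) (set_map f k R)
  end
with el_map K (f : nat -> nat -> tm K) (k : nat) (s : el K) : el K :=
  match s with
  | evar => evar
  | eid a => eid (obj_map f k a)
  | eind t a s b =>
      eind (el_map f k t) (obj_map f k a) (el_map f k s) (obj_map f k b)
  | rlam t => rlam (el_map f k t)
  | rapp s a t => rapp (el_map f k s) (obj_map f k a) (el_map f k t)
  | llam t => llam (el_map f k t)
  | lapp s a t => lapp (el_map f k s) (obj_map f k a) (el_map f k t)
  | eall M a => eall (tm_map f k M) (obj_map f k a)
  end.

Fixpoint ty_map K (f : nat -> nat -> tm K) (k : nat) (A : ty K) : ty K :=
  match A with
  | tUnit => tUnit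
  | tPi A B => tPi (ty_map f k A) (ty_map f (S k) B)
  | tSigma A B => tSigma (ty_map f k A) (ty_map f (S k) B)
  | tId A M N => tId (ty_map f k A) (tm_map f k M) (tm_map f k N)
  | tFun C D => tFun (cat_map f k C) (cat_map f k D)
  | tProf C D => tProf (cat_map f k C) (cat_map f k D)
  | tAll C P => tAll (cat_map f k C) (set_map f k P)
  end.

Definition shift_var K (d k n : nat) : tm K :=
  if n <? k then tvar n else tvar (n + d).

Definition ty_shift K (d : nat) (A : ty K) : ty K := ty_map (@shift_var K d) 0 A.
Definition tm_shift K (d : nat) (M : tm K) : tm K := tm_map (@shift_var K d) 0 M.

Definition inst_var K (N : tm K) (k n : nat) : tm K :=
  match n ?= k with
  | Lt => tvar n
  | Eq => tm_shift k N
  | Gt => tvar (pred n)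
  end.

Definition ty_inst K (A : ty K) (N : tm K) : ty K := ty_map (inst_var N) 0 A.
Definition tm_inst K (M N : tm K) : tm K := tm_map (inst_var N) 0 M.

(** * Substitution for object and element variables *)

(** [osub a b] is a[b/α]. *)
Fixpoint osub K (a b : obj K) : obj K :=
  match a with
  | ovar => b
  | oapp M a => oapp M (osub a b)
  end.

(** [ssub R a b] is R[a/α;b/β].  For a set P in a context with a single
    variable α, P[a/α] is [ssub P a a]. *)
Fixpoint ssub K (R : set K) (a b : obj K) : set K :=
  match R with
  | hom C a' b' => hom C (osub a' a) (osub b' b)
  | papp M a' b' => papp M (osub a' a) (osub b' b)
  | rhom C R P => rhom C (ssub R b ovar) (ssub P a ovar)
  | lhom C P R => lhom C (ssub P ovar b) (ssub R ovar a)
  end.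

(** A transformation substitution a_1/α_1, s_1/x_1, a_2/α_2, ..., s_n/x_n,
    a_{n+1}/α_{n+1} is the pair of a_1 and the list of the (s_i, a_{i+1}). *)
Definition tsub (K : Type) : Type := (obj K * list (el K * obj K))%type.

Definition tsub_first K (φ : tsub K) : obj K := fst φ.
Definition tsub_last K (φ : tsub K) : obj K := last (map snd (snd φ)) (fst φ).
Definition tsub_take K (k : nat) (φ : tsub K) : tsub K :=
  (fst φ, firstn k (snd φ)).
Definition tsub_drop K (k : nat) (φ : tsub K) : tsub K :=
  (tsub_last (tsub_take k φ), skipn k (snd φ)).
Definition tsub_snoc K (φ : tsub K) (s : el K) (a : obj K) : tsub K :=
  (fst φ, snd φ ++ [(s, a)]).
Definition tsub_cons K (a : obj K) (s : el K) (φ : tsub K) : tsub K :=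
  (a, (s, fst φ) :: snd φ).

(** The identity substitution of a context with [n] element variables. *)
Definition tsub_id K (n : nat) : tsub K := (ovar, repeat (evar, ovar) n).

(** The number of element variables in the context of [s]. *)
Fixpoint nvars K (s : el K) : nat :=
  match s with
  | evar => 1
  | eid _ => 0
  | eind _ _ s _ => nvars s
  | rlam t => pred (nvars t)
  | rapp s _ t => nvars s + nvars t
  | llam t => pred (nvars t)
  | lapp s _ t => nvars s + nvars t
  | eall _ _ => 0
  end.

(** [esub s φ] is s[φ]; φ is split at the shared object variable in a term
    over a concatenation of contexts. *)
Fixpoint esub K (s : el K) (φ : tsub K) : el K :=
  match s with
  | evar => match snd φ with (s1, _) :: _ => s1 | [] => evar end
  | eid a => eid (osub a (tsub_first φ))
  | eind t a s b =>
      eind t (osub a (tsub_first φ)) (esub s φ) (osub b (tsub_last φ))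
  | rlam t => rlam (esub t (tsub_snoc φ evar ovar))
  | rapp s a t =>
      rapp (esub s (tsub_take (nvars s) φ)) (osub a (tsub_last φ))
           (esub t (tsub_drop (nvars s) φ))
  | llam t => llam (esub t (tsub_cons ovar evar φ))
  | lapp s a t =>
      lapp (esub s (tsub_take (nvars s) φ)) (osub a (tsub_first φ))
           (esub t (tsub_drop (nvars s) φ))
  | eall M a => eall M (osub a (tsub_first φ))
  end.

(** * Contexts *)

(** Γ, most recent hypothesis first. *)
Definition ctx (K : Type) : Type := list (ty K).

Inductive lookup K : ctx K -> nat -> ty K -> Prop :=
  | lookup_O Γ A : lookup (A :: Γ) 0 (ty_shift 1 A)
  | lookup_S Γ n A B : lookup Γ n A -> lookup (B :: Γ) (S n) (ty_shift 1 A).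

(** Set contexts Ξ: α:C, or α:C; β:D. *)
Inductive sctx (K : Type) : Type :=
  | One (C : cat K)
  | Two (C D : cat K).

Definition sneg K (Ξ : sctx K) : cat K :=
  match Ξ with One C => C | Two C _ => C end.
Definition spos K (Ξ : sctx K) : cat K :=
  match Ξ with One C => C | Two _ D => D end.

(** A transformation context α_1:C_1, x_1:R_1, α_2:C_2, ..., x_n:R_n,
    α_{n+1}:C_{n+1} is the pair of C_1 and the list of the (R_i, C_{i+1}). *)
Definition ectx (K : Type) : Type := (cat K * list (set K * cat K))%type.

Definition eneg K (Φ : ectx K) : cat K := fst Φ.
Definition epos K (Φ : ectx K) : cat K := last (map snd (snd Φ)) (fst Φ).
Definition under K (Φ : ectx K) : sctx K :=
  match snd Φ with
  | [] => One (fst Φ)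
  | _ :: _ => Two (eneg Φ) (epos Φ)
  end.
Definition elen K (Φ : ectx K) : nat := length (snd Φ).

Definition esnoc K (Φ : ectx K) (R : set K) (C : cat K) : ectx K :=
  (fst Φ, snd Φ ++ [(R, C)]).
Definition econs K (C : cat K) (R : set K) (Φ : ectx K) : ectx K :=
  (C, (R, fst Φ) :: snd Φ).

(** Φ ⋈ Ψ, meaningful when d⁺Φ = d⁻Ψ. *)
Definition ejoin K (Φ Ψ : ectx K) : ectx K := (fst Φ, snd Φ ++ snd Ψ).

(** * Judgments and derivability

    A typing judgment is the diagonal of the corresponding equality judgment:
    Γ ⊢ M : A is Γ ⊢ M = M : A, and so on.  Each formation, introduction and
    elimination rule is therefore stated once, in its congruence form. *)

Inductive jdg (K : Type) : Type :=
  | okCtx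
  | eqTy (A A' : ty K)
  | eqTm (M M' : tm K) (A : ty K)
  | eqCat (C C' : cat K)
  | Small (C : cat K)
  | eqObj (C : cat K) (a a' : obj K) (D : cat K)   (* α:C ⊢ a = a' : D *)
  | eqSctx (Ξ Ξ' : sctx K)
  | eqSet (Ξ : sctx K) (R R' : set K)              (* Ξ ⊢ R = R' Set *)
  | eqEctx (Φ Φ' : ectx K)
  | eqEl (Φ : ectx K) (s s' : el K) (R : set K).   (* Φ ⊢ s = s' : R *)

Arguments okCtx {K}.

Notation isTy A := (eqTy A A).
Notation isTm M A := (eqTm M M A).
Notation isCat C := (eqCat C C).
Notation isObj C a D := (eqObj C a a D).
Notation isSctx Ξ := (eqSctx Ξ Ξ).
Notation isSet Ξ R := (eqSet Ξ R R).
Notation isEctx Φ := (eqEctx Φ Φ).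
Notation isEl Φ s R := (eqEl Φ s s R).

Reserved Notation "Γ ⊢ J" (at level 70, no associativity).

Inductive der (S : signature) : ctx (csym S) -> jdg (csym S) -> Prop :=

(* Equality is an equivalence relation, and judgments respect it. *)
| ty_sym Γ A B : Γ ⊢ eqTy A B -> Γ ⊢ eqTy B A
| ty_trans Γ A B C : Γ ⊢ eqTy A B -> Γ ⊢ eqTy B C -> Γ ⊢ eqTy A C
| tm_sym Γ M N A : Γ ⊢ eqTm M N A -> Γ ⊢ eqTm N M A
| tm_trans Γ M N P A : Γ ⊢ eqTm M N A -> Γ ⊢ eqTm N P A -> Γ ⊢ eqTm M P A
| tm_conv Γ M N A B : Γ ⊢ eqTm M N A -> Γ ⊢ eqTy A B -> Γ ⊢ eqTm M N B
| cat_sym Γ C D : Γ ⊢ eqCat C D -> Γ ⊢ eqCat D C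
| cat_trans Γ C D E : Γ ⊢ eqCat C D -> Γ ⊢ eqCat D E -> Γ ⊢ eqCat C E
| small_conv Γ C D : Γ ⊢ Small C -> Γ ⊢ eqCat C D -> Γ ⊢ Small D
| obj_sym Γ C a b D : Γ ⊢ eqObj C a b D -> Γ ⊢ eqObj C b a D
| obj_trans Γ C a b c D :
    Γ ⊢ eqObj C a b D -> Γ ⊢ eqObj C b c D -> Γ ⊢ eqObj C a c D
| obj_conv Γ C C' a b D D' :
    Γ ⊢ eqObj C a b D -> Γ ⊢ eqCat C C' -> Γ ⊢ eqCat D D' ->
    Γ ⊢ eqObj C' a b D'
| sctx_sym Γ Ξ Ξ' : Γ ⊢ eqSctx Ξ Ξ' -> Γ ⊢ eqSctx Ξ' Ξ
| sctx_trans Γ Ξ Ξ' Ξ'' :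
    Γ ⊢ eqSctx Ξ Ξ' -> Γ ⊢ eqSctx Ξ' Ξ'' -> Γ ⊢ eqSctx Ξ Ξ''
| set_sym Γ Ξ R P : Γ ⊢ eqSet Ξ R P -> Γ ⊢ eqSet Ξ P R
| set_trans Γ Ξ R P Q :
    Γ ⊢ eqSet Ξ R P -> Γ ⊢ eqSet Ξ P Q -> Γ ⊢ eqSet Ξ R Q
| set_conv Γ Ξ Ξ' R P : Γ ⊢ eqSet Ξ R P -> Γ ⊢ eqSctx Ξ Ξ' -> Γ ⊢ eqSet Ξ' R P
| ectx_sym Γ Φ Φ' : Γ ⊢ eqEctx Φ Φ' -> Γ ⊢ eqEctx Φ' Φ
| ectx_trans Γ Φ Φ' Φ'' :
    Γ ⊢ eqEctx Φ Φ' -> Γ ⊢ eqEctx Φ' Φ'' -> Γ ⊢ eqEctx Φ Φ''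
| el_sym Γ Φ s t R : Γ ⊢ eqEl Φ s t R -> Γ ⊢ eqEl Φ t s R
| el_trans Γ Φ s t u R :
    Γ ⊢ eqEl Φ s t R -> Γ ⊢ eqEl Φ t u R -> Γ ⊢ eqEl Φ s u R
| el_conv Γ Φ Φ' s t R R' :
    Γ ⊢ eqEl Φ s t R -> Γ ⊢ eqEctx Φ Φ' -> Γ ⊢ eqSet (under Φ) R R' ->
    Γ ⊢ eqEl Φ' s t R'

(* Outer contexts and variables. *)
| ctx_nil : [] ⊢ okCtx
| ctx_cons Γ A : Γ ⊢ okCtx -> Γ ⊢ isTy A -> (A :: Γ) ⊢ okCtx
| tm_var Γ n A : Γ ⊢ okCtx -> lookup Γ n A -> Γ ⊢ isTm (tvar n) A

(* Unit type. *)
| unit_form Γ : Γ ⊢ okCtx -> Γ ⊢ isTy tUnit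
| unit_intro Γ : Γ ⊢ okCtx -> Γ ⊢ isTm tstar tUnit
| unit_eta Γ M : Γ ⊢ isTm M tUnit -> Γ ⊢ eqTm M tstar tUnit

(* Dependent functions. *)
| pi_form Γ A A' B B' :
    Γ ⊢ eqTy A A' -> (A :: Γ) ⊢ eqTy B B' -> Γ ⊢ eqTy (tPi A B) (tPi A' B')
| pi_intro Γ A B M M' :
    Γ ⊢ isTy A -> (A :: Γ) ⊢ eqTm M M' B ->
    Γ ⊢ eqTm (tlam M) (tlam M') (tPi A B)
| pi_elim Γ A B M M' N N' :
    Γ ⊢ eqTm M M' (tPi A B) -> Γ ⊢ eqTm N N' A ->
    Γ ⊢ eqTm (tapp M N) (tapp M' N') (ty_inst B N)
| pi_beta Γ A B M N :
    Γ ⊢ isTy A -> (A :: Γ) ⊢ isTm M B -> Γ ⊢ isTm N A ->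
    Γ ⊢ eqTm (tapp (tlam M) N) (tm_inst M N) (ty_inst B N)
| pi_eta Γ A B M :
    Γ ⊢ isTm M (tPi A B) ->
    Γ ⊢ eqTm M (tlam (tapp (tm_shift 1 M) (tvar 0))) (tPi A B)

(* Dependent pairs. *)
| sigma_form Γ A A' B B' :
    Γ ⊢ eqTy A A' -> (A :: Γ) ⊢ eqTy B B' ->
    Γ ⊢ eqTy (tSigma A B) (tSigma A' B')
| sigma_intro Γ A B M M' N N' :
    (A :: Γ) ⊢ isTy B -> Γ ⊢ eqTm M M' A -> Γ ⊢ eqTm N N' (ty_inst B M) ->
    Γ ⊢ eqTm (tpair M N) (tpair M' N') (tSigma A B)
| sigma_fst Γ A B M M' :
    Γ ⊢ eqTm M M' (tSigma A B) -> Γ ⊢ eqTm (tfst M) (tfst M') A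
| sigma_snd Γ A B M M' :
    Γ ⊢ eqTm M M' (tSigma A B) ->
    Γ ⊢ eqTm (tsnd M) (tsnd M') (ty_inst B (tfst M))
| sigma_beta1 Γ A B M N :
    (A :: Γ) ⊢ isTy B -> Γ ⊢ isTm M A -> Γ ⊢ isTm N (ty_inst B M) ->
    Γ ⊢ eqTm (tfst (tpair M N)) M A
| sigma_beta2 Γ A B M N :
    (A :: Γ) ⊢ isTy B -> Γ ⊢ isTm M A -> Γ ⊢ isTm N (ty_inst B M) ->
    Γ ⊢ eqTm (tsnd (tpair M N)) N (ty_inst B M)
| sigma_eta Γ A B M :
    Γ ⊢ isTm M (tSigma A B) -> Γ ⊢ eqTm M (tpair (tfst M) (tsnd M)) (tSigma A B)

(* Extensional identity types. *)
| id_form Γ A A' M M' N N' :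
    Γ ⊢ eqTy A A' -> Γ ⊢ eqTm M M' A -> Γ ⊢ eqTm N N' A ->
    Γ ⊢ eqTy (tId A M N) (tId A' M' N')
| id_intro Γ A M : Γ ⊢ isTm M A -> Γ ⊢ isTm trefl (tId A M M)
| id_reflection Γ A M N P : Γ ⊢ isTm P (tId A M N) -> Γ ⊢ eqTm M N A
| id_unique Γ A M N P :
    Γ ⊢ isTm P (tId A M N) -> Γ ⊢ eqTm P trefl (tId A M N)

(* Base categories. *)
| cat_base Γ k M M' :
    [] ⊢ isTy (cpar k) -> Γ ⊢ eqTm M M' (cpar k) ->
    Γ ⊢ eqCat (cbase k M) (cbase k M')
| small_base Γ k M :
    Γ ⊢ isCat (cbase k M) -> csmall k -> Γ ⊢ Small (cbase k M)

(* Set contexts and transformation contexts. *)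
| sctx_one Γ C C' : Γ ⊢ eqCat C C' -> Γ ⊢ eqSctx (One C) (One C')
| sctx_two Γ C C' D D' :
    Γ ⊢ eqCat C C' -> Γ ⊢ eqCat D D' -> Γ ⊢ eqSctx (Two C D) (Two C' D')
| ectx_one Γ C C' : Γ ⊢ eqCat C C' -> Γ ⊢ eqEctx (C, []) (C', [])
| ectx_snoc Γ Φ Φ' R R' C C' :
    Γ ⊢ eqEctx Φ Φ' -> Γ ⊢ eqCat C C' -> Γ ⊢ eqSet (Two (epos Φ) C) R R' ->
    Γ ⊢ eqEctx (esnoc Φ R C) (esnoc Φ' R' C')

(* Object variables and element variables. *)
| obj_var Γ C : Γ ⊢ isCat C -> Γ ⊢ isObj C ovar C
| el_var Γ C R D :
    Γ ⊢ isEctx (C, [(R, D)]) -> Γ ⊢ isEl (C, [(R, D)]) evar R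

(* Fun C D. *)
| fun_form Γ C C' D D' :
    Γ ⊢ eqCat C C' -> Γ ⊢ eqCat D D' -> Γ ⊢ eqTy (tFun C D) (tFun C' D')
| fun_intro Γ C D a a' :
    Γ ⊢ eqObj C a a' D -> Γ ⊢ eqTm (mFun a) (mFun a') (tFun C D)
| fun_elim Γ B C D M M' a a' :
    Γ ⊢ eqTm M M' (tFun C D) -> Γ ⊢ eqObj B a a' C ->
    Γ ⊢ eqObj B (oapp M a) (oapp M' a') D
| fun_beta Γ B C D a b :
    Γ ⊢ isObj C a D -> Γ ⊢ isObj B b C ->
    Γ ⊢ eqObj B (oapp (mFun a) b) (osub a b) D
| fun_eta Γ C D M :
    Γ ⊢ isTm M (tFun C D) -> Γ ⊢ eqTm M (mFun (oapp M ovar)) (tFun C D)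

(* Prof C D. *)
| prof_form Γ C C' D D' :
    Γ ⊢ eqCat C C' -> Γ ⊢ eqCat D D' -> Γ ⊢ eqTy (tProf C D) (tProf C' D')
| prof_intro Γ C D R R' :
    Γ ⊢ eqSet (Two C D) R R' -> Γ ⊢ eqTm (mProf R) (mProf R') (tProf C D)
| prof_elim Γ Ξ C D M M' a a' b b' :
    Γ ⊢ eqTm M M' (tProf C D) ->
    Γ ⊢ eqObj (sneg Ξ) a a' C -> Γ ⊢ eqObj (spos Ξ) b b' D ->
    Γ ⊢ eqSet Ξ (papp M a b) (papp M' a' b')
| prof_beta Γ Ξ C D R a b :
    Γ ⊢ isSet (Two C D) R ->
    Γ ⊢ isObj (sneg Ξ) a C -> Γ ⊢ isObj (spos Ξ) b D ->
    Γ ⊢ eqSet Ξ (papp (mProf R) a b) (ssub R a b)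
| prof_eta Γ C D M :
    Γ ⊢ isTm M (tProf C D) -> Γ ⊢ eqTm M (mProf (papp M ovar ovar)) (tProf C D)

(* ∀α:C. P. *)
| all_form Γ C C' P P' :
    Γ ⊢ eqCat C C' -> Γ ⊢ eqSet (One C) P P' -> Γ ⊢ eqTy (tAll C P) (tAll C' P')
| all_intro Γ C P t t' :
    Γ ⊢ isSet (One C) P -> Γ ⊢ eqEl (C, []) t t' P ->
    Γ ⊢ eqTm (mAll t) (mAll t') (tAll C P)
| all_elim Γ D C P M M' a a' :
    Γ ⊢ eqTm M M' (tAll C P) -> Γ ⊢ eqObj D a a' C ->
    Γ ⊢ eqEl (D, []) (eall M a) (eall M' a') (ssub P a a)
| all_beta Γ D C P t a :
    Γ ⊢ isSet (One C) P -> Γ ⊢ isEl (C, []) t P -> Γ ⊢ isObj D a C ->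
    Γ ⊢ eqEl (D, []) (eall (mAll t) a) (esub t (a, [])) (ssub P a a)
| all_eta Γ C P M :
    Γ ⊢ isTm M (tAll C P) -> Γ ⊢ eqTm M (mAll (eall M ovar)) (tAll C P)

(* Unit: the morphism set a →_C b. *)
| hom_form Γ Ξ C C' a a' b b' :
    Γ ⊢ eqCat C C' ->
    Γ ⊢ eqObj (sneg Ξ) a a' C -> Γ ⊢ eqObj (spos Ξ) b b' C ->
    Γ ⊢ eqSet Ξ (hom C a b) (hom C' a' b')
| hom_intro Γ D C a a' :
    Γ ⊢ eqObj D a a' C -> Γ ⊢ eqEl (D, []) (eid a) (eid a') (hom C a a)
| hom_elim Γ Φ C P t t' a a' s s' b b' :
    Γ ⊢ isSet (Two C C) P ->
    Γ ⊢ eqEl (C, []) t t' (ssub P ovar ovar) ->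
    Γ ⊢ eqObj (eneg Φ) a a' C -> Γ ⊢ eqObj (epos Φ) b b' C ->
    Γ ⊢ eqEl Φ s s' (hom C a b) ->
    Γ ⊢ eqEl Φ (eind t a s b) (eind t' a' s' b') (ssub P a b)
| hom_beta Γ D C P t a :
    Γ ⊢ isSet (Two C C) P ->
    Γ ⊢ isEl (C, []) t (ssub P ovar ovar) ->
    Γ ⊢ isObj D a C ->
    Γ ⊢ eqEl (D, []) (eind t a (eid a) a) (esub t (a, [])) (ssub P a a)
| hom_eta Γ C R s :
    Γ ⊢ isEl (C, [(hom C ovar ovar, C)]) s R ->
    Γ ⊢ eqEl (C, [(hom C ovar ovar, C)])
          s (eind (esub s (ovar, [(eid ovar, ovar)])) ovar evar ovar) R

(* Right hom. *)
| rhom_form Γ Ξ C C' R R' P P' :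
    Γ ⊢ Small (spos Ξ) -> Γ ⊢ isSctx Ξ -> Γ ⊢ eqCat C C' ->
    Γ ⊢ eqSet (Two (spos Ξ) C) R R' -> Γ ⊢ eqSet (Two (sneg Ξ) C) P P' ->
    Γ ⊢ eqSet Ξ (rhom C R P) (rhom C' R' P')
| rhom_intro Γ Φ C R P t t' :
    Γ ⊢ isSet (under Φ) (rhom C R P) ->
    Γ ⊢ eqEl (esnoc Φ R C) t t' P ->
    Γ ⊢ eqEl Φ (rlam t) (rlam t') (rhom C R P)
| rhom_elim Γ Φf Φa C R P s s' a a' t t' :
    epos Φf = eneg Φa ->
    Γ ⊢ eqEl Φf s s' (rhom C R P) ->
    Γ ⊢ eqObj (epos Φa) a a' C ->
    Γ ⊢ eqEl Φa t t' (ssub R ovar a) ->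
    Γ ⊢ eqEl (ejoin Φf Φa) (rapp s a t) (rapp s' a' t') (ssub P ovar a)
| rhom_beta Γ Φf Φa C R P s a t :
    epos Φf = eneg Φa ->
    Γ ⊢ isSet (under Φf) (rhom C R P) ->
    Γ ⊢ isEl (esnoc Φf R C) s P ->
    Γ ⊢ isObj (epos Φa) a C ->
    Γ ⊢ isEl Φa t (ssub R ovar a) ->
    Γ ⊢ eqEl (ejoin Φf Φa) (rapp (rlam s) a t)
          (esub s (tsub_snoc (tsub_id _ (elen Φf)) t a)) (ssub P ovar a)
| rhom_eta Γ Φ C R P s :
    Γ ⊢ isEl Φ s (rhom C R P) ->
    Γ ⊢ eqEl Φ s (rlam (rapp s ovar evar)) (rhom C R P)

(* Left hom. *)
| lhom_form Γ Ξ C C' R R' P P' :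
    Γ ⊢ Small (sneg Ξ) -> Γ ⊢ isSctx Ξ -> Γ ⊢ eqCat C C' ->
    Γ ⊢ eqSet (Two C (sneg Ξ)) R R' -> Γ ⊢ eqSet (Two C (spos Ξ)) P P' ->
    Γ ⊢ eqSet Ξ (lhom C P R) (lhom C' P' R')
| lhom_intro Γ Φ C R P t t' :
    Γ ⊢ isSet (under Φ) (lhom C P R) ->
    Γ ⊢ eqEl (econs C R Φ) t t' P ->
    Γ ⊢ eqEl Φ (llam t) (llam t') (lhom C P R)
| lhom_elim Γ Φa Φf C R P s s' a a' t t' :
    epos Φa = eneg Φf ->
    Γ ⊢ eqObj (eneg Φa) a a' C ->
    Γ ⊢ eqEl Φa s s' (ssub R a ovar) ->
    Γ ⊢ eqEl Φf t t' (lhom C P R) ->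
    Γ ⊢ eqEl (ejoin Φa Φf) (lapp s a t) (lapp s' a' t') (ssub P a ovar)
| lhom_beta Γ Φa Φf C R P s a t :
    epos Φa = eneg Φf ->
    Γ ⊢ isObj (eneg Φa) a C ->
    Γ ⊢ isEl Φa s (ssub R a ovar) ->
    Γ ⊢ isSet (under Φf) (lhom C P R) ->
    Γ ⊢ isEl (econs C R Φf) t P ->
    Γ ⊢ eqEl (ejoin Φa Φf) (lapp s a (llam t))
          (esub t (tsub_cons a s (tsub_id _ (elen Φf)))) (ssub P a ovar)
| lhom_eta Γ Φ C R P t :
    Γ ⊢ isEl Φ t (lhom C P R) ->
    Γ ⊢ eqEl Φ t (llam (lapp evar ovar t)) (lhom C P R)

where "Γ ⊢ J" := (der Γ J).

(** [A] is a type in Γ and a term of it can be constructed. *)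
Definition inhabited_type (S : signature) (Γ : ctx (csym S)) (A : ty (csym S)) :
  Prop := Γ ⊢ isTy A /\ exists M, Γ ⊢ isTm M A.

(* Main.v *)
Require Import Defs.
From Stdlib Require Import List.
Import ListNotations.

(** A natural family of elements over morphisms is determined by its values at
    identities: hom-elimination turns an element of the diagonal of [P] into a
    map from the morphism set to [P].  Composition comes from the identity map
    of a morphism set, functoriality from [id_(F α)].  In profunctoriality the
    second morphism is not the first variable of its context, so that
    hom-elimination does not apply to it directly; its action is constructed as
    an element of a left hom and then applied to the element of [R]. *)

Lemma osub_ovar K (a : obj K) : osub a ovar = a.
Proof. induction a as [|M a IH]; simpl; congruence. Qed.

(** Used to bring a goal into the form [ssub _ ovar ovar] in which the elimination rules
    conclude. *)
Lemma ssub_ovar K (R : set K) : ssub R ovar ovar = R.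
Proof. induction R; simpl; rewrite ?osub_ovar; congruence. Qed.

Section Terms.

Variables (S : signature) (Γ : ctx (csym S)).

Lemma isSet_hom_ovar Ξ C :
  Γ ⊢ isCat C -> sneg Ξ = C -> spos Ξ = C -> Γ ⊢ isSet Ξ (hom C ovar ovar).
Proof.
  intros hC hn hp; apply hom_form; [assumption | rewrite hn | rewrite hp];
    apply obj_var; assumption.
Qed.

Lemma isSet_papp_ovar C D R :
  Γ ⊢ isCat C -> Γ ⊢ isCat D -> Γ ⊢ isTm R (tProf C D) ->
  Γ ⊢ isSet (Two C D) (papp R ovar ovar).
Proof.
  intros hC hD hR.
  apply (@prof_elim S Γ (Two C D) C D); [assumption | |]; apply obj_var; assumption.
Qed.

Lemma isEl_evar C D R :
  Γ ⊢ isCat C -> Γ ⊢ isCat D -> Γ ⊢ isSet (Two C D) R ->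
  Γ ⊢ isEl (C, [(R, D)]) evar R.
Proof.
  intros hC hD hR; apply el_var.
  apply (@ectx_snoc S Γ (C, []) (C, [])); [apply ectx_one | |]; assumption.
Qed.

Lemma isEl_rlam_evar C D R :
  Γ ⊢ isCat C -> Γ ⊢ isCat D -> Γ ⊢ Small C -> Γ ⊢ isSet (Two C D) R ->
  Γ ⊢ isEl (C, []) (rlam evar) (rhom D R R).
Proof.
  intros hC hD hs hR; apply rhom_intro.
  - apply rhom_form; try assumption; apply sctx_one; assumption.
  - apply isEl_evar; assumption.
Qed.

Lemma isEl_llam_evar C D R :
  Γ ⊢ isCat C -> Γ ⊢ isCat D -> Γ ⊢ Small D -> Γ ⊢ isSet (Two C D) R ->
  Γ ⊢ isEl (D, []) (llam evar) (lhom C R R).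
Proof.
  intros hC hD hs hR; apply lhom_intro.
  - apply lhom_form; try assumption; apply sctx_one; assumption.
  - apply isEl_evar; assumption.
Qed.

Lemma isEl_eind_evar C P t :
  Γ ⊢ isCat C -> Γ ⊢ isSet (Two C C) P -> Γ ⊢ isEl (C, []) t P ->
  Γ ⊢ isEl (C, [(hom C ovar ovar, C)]) (eind t ovar evar ovar) P.
Proof.
  intros hC hP ht; rewrite <- (ssub_ovar _ P).
  apply hom_elim with (C := C); try assumption.
  - rewrite ssub_ovar; assumption.
  - apply obj_var; assumption.
  - apply obj_var; assumption.
  - apply isEl_evar; try assumption; apply isSet_hom_ovar; trivial.
Qed.

(** Shape shared by composition, functoriality and profunctoriality: each then needs only its value
    [t] at identities. *)
Lemma inhabited_all_rhom_hom C P t :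
  Γ ⊢ isCat C -> Γ ⊢ Small C ->
  Γ ⊢ isSet (Two C C) P -> Γ ⊢ isEl (C, []) t P ->
  inhabited_type Γ (tAll C (rhom C (hom C ovar ovar) P)).
Proof.
  intros hC hs hP ht.
  assert (hset : Γ ⊢ isSet (One C) (rhom C (hom C ovar ovar) P)).
  { apply rhom_form; try assumption.
    - apply sctx_one; assumption.
    - apply isSet_hom_ovar; trivial. }
  split; [apply all_form; assumption |].
  exists (mAll (rlam (eind t ovar evar ovar))).
  apply all_intro; [assumption |].
  apply rhom_intro; [assumption |].
  apply isEl_eind_evar; assumption.
Qed.

Lemma isSet_postcomposition C D R :
  Γ ⊢ isCat C -> Γ ⊢ isCat D -> Γ ⊢ Small D -> Γ ⊢ isSet (Two C D) R ->
  Γ ⊢ isSet (Two C D) (rhom D (hom D ovar ovar) R).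
Proof.
  intros hC hD hs hR; apply rhom_form; try assumption.
  - apply sctx_two; assumption.
  - apply isSet_hom_ovar; trivial.
Qed.

(** Inside [eind], [llam evar] says that an identity of [D] acts on [R] as the identity. *)
Lemma isEl_postcomposition C D R :
  Γ ⊢ isCat C -> Γ ⊢ isCat D -> Γ ⊢ Small D -> Γ ⊢ isSet (Two C D) R ->
  Γ ⊢ isEl (C, [(R, D)])
        (rlam (lapp evar ovar (eind (llam evar) ovar evar ovar)))
        (rhom D (hom D ovar ovar) R).
Proof.
  intros hC hD hs hR; apply rhom_intro.
  - apply isSet_postcomposition; assumption.
  - rewrite <- (ssub_ovar _ R) at 2.
    (* The context is split at the variable of [D] shared by [R] and the morphism: argument on the
       left, function on the right. *)
    apply (@lhom_elim S Γ (C, [(R, D)]) (D, [(hom D ovar ovar, D)]) C R).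
    + reflexivity.
    + apply obj_var; assumption.
    + rewrite ssub_ovar; apply isEl_evar; assumption.
    + apply isEl_eind_evar; [assumption | | apply isEl_llam_evar; assumption].
      apply lhom_form; try assumption; apply sctx_two; assumption.
Qed.

End Terms.

(* An occurrence of [ovar] denotes the object variable forced by its position;
   the named form of each type is given beside it. *)
Theorem mainTheorem4 (S : signature) (Γ : ctx (csym S)) (hΓ : Γ ⊢ okCtx)
    (C : cat (csym S)) (hC : Γ ⊢ isCat C) (hCsmall : Γ ⊢ Small C) :
  (* ∀α. α → α *)
  inhabited_type Γ (tAll C (hom C ovar ovar))
  /\
  (* ∀α1. (α1 → α2) ▷^{∀α2} ((α2 → α3) ▷^{∀α3} (α1 → α3)) *)
  inhabited_type Γ
    (tAll C (rhom C (hom C ovar ovar)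
               (rhom C (hom C ovar ovar)
                       (hom C ovar ovar))))
  /\
  (* ∀α1. (α1 → α2) ▷^{∀α2} (F α1 → F α2) *)
  (forall (D : cat (csym S)) (F : tm (csym S)),
     Γ ⊢ isCat D -> Γ ⊢ isTm F (tFun C D) ->
     inhabited_type Γ
       (tAll C (rhom C (hom C ovar ovar)
                       (hom D (oapp F ovar) (oapp F ovar)))))
  /\
  (* ∀α1. (α1 → α2) ▷^{∀α2} (R α2 β2 ▷^{∀β2} ((β2 → β1) ▷^{∀β1} R α1 β1)) *)
  (forall (D : cat (csym S)) (R : tm (csym S)),
     Γ ⊢ isCat D -> Γ ⊢ Small D -> Γ ⊢ isTm R (tProf C D) ->
     inhabited_type Γ
       (tAll C (rhom C (hom C ovar ovar)
                  (rhom D (papp R ovar ovar)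
                     (rhom D (hom D ovar ovar)
                             (papp R ovar ovar)))))).
Proof.
  split; [| split; [| split]].
  - assert (hset : Γ ⊢ isSet (One C) (hom C ovar ovar))
      by (apply isSet_hom_ovar; trivial).
    split; [apply all_form; assumption |].
    exists (mAll (eid ovar)).
    apply all_intro; [assumption |].
    apply hom_intro, obj_var; assumption.
  - assert (hhom : Γ ⊢ isSet (Two C C) (hom C ovar ovar))
      by (apply isSet_hom_ovar; trivial).
    (* When the first morphism is an identity, the composite is the second morphism itself, hence
       [rlam evar]. *)
    apply inhabited_all_rhom_hom with (t := rlam evar); try assumption.
    + apply isSet_postcomposition; assumption.
    + apply isEl_rlam_evar; assumption.
  - intros D F hD hF.
    assert (hFv : Γ ⊢ isObj C (oapp F ovar) D)
      by (apply fun_elim with (C := C); [assumption | apply obj_var; assumption]).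
    apply inhabited_all_rhom_hom with (t := eid (oapp F ovar)); try assumption.
    + apply hom_form; assumption.
    + apply hom_intro; assumption.
  - intros D R hD hDsmall hR.
    assert (hRv := isSet_papp_ovar S Γ C D R hC hD hR).
    assert (hpost := isSet_postcomposition S Γ C D _ hC hD hDsmall hRv).
    (* [t] is left open: over an identity of [C] only the action of [D] remains, so it becomes
       [rlam] of the postcomposition element. *)
    eapply inhabited_all_rhom_hom; try assumption.
    + apply rhom_form; try assumption; apply sctx_two; assumption.
    + apply rhom_intro.
      * apply rhom_form; try assumption; apply sctx_one; assumption.
      * apply isEl_postcomposition; assumption.
Qed.
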